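(* Let $n>c_1>c_2$ be positive integers and let $\Sigma$ be an even positive integer. Put $Q=(c_1-c_2+1)^2-4c_2(n-1-c_1)$. Suppose $\beta>0$, $r\in\mathbb N$ and $\varepsilon=\frac{3(r+3)}{\beta(c_1-c_2)}$. If $$(1-\beta)(c_1-c_2+1)^2\ge 4c_2(n-1-c_1)$$ and $$\left|\frac{\Sigma-nc_2}{(c_1-c_2)/2}-(1+c_1+c_2)\right|\le(1-\varepsilon)\sqrt{Q},$$ then the simple region $\mathbb D(n,\Sigma,c_1,c_2)$ contains a (graphic) degree sequence $D$ such that $$\partial^{++}(D)\ge 2^{r/2}.$$
   Context: A degree sequence of length $n$ is a sequence $D=(d_1,\dots,d_n)$ of positive integers, each at most $n-1$, with even sum. It is graphic if there is a simple graph on vertex set $\{1,\dots,n\}$ in which vertex $i$ has degree $d_i$ for every $i$; such a graph is called a realization of $D$. $\mathcal G(D)$ denotes the set of all (labelled) realizations of $D$; it is empty if $D$ (an arbitrary integer vector) has no realization. For positive integers $n>c_1\ge c_2$ and even $\Sigma$, $\mathbb D(n,\Sigma,c_1,c_2)$ is the set of all degree sequences $(d_1,\dots,d_n)$ of length $n$ with $c_1\ge d_i\ge c_2$ for all $i$ and $\sum_i d_i=\Sigma$. For $1\le i,j\le n$, $1^{+i}_{+j}$ denotes the integer vector $e_i+e_j$ of length $n$, where $e_i$ is the $i$th standard unit vector. For a graphic degree sequence $D$ of length $n$ (the quantity is defined only for graphic $D$), $$\partial^{++}(D)=\sum_{1\le i<j\le n}\frac{|\mathcal G(D+1^{+i}_{+j})|}{|\mathcal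 G(D)|}.$$ *)

(* Defs.v *)
From mathcomp Require Import all_boot all_order all_algebra.
From mathcomp Require Import reals exp.

Set Implicit Arguments.
Unset Strict Implicit.
Unset Printing Implicit Defensive.

Import Order.TTheory GRing.Theory Num.Theory.

Local Open Scope nat_scope.

(* A labelled simple graph on {1,...,n} is encoded by its adjacency relation,
   stored as a finite function so that the realizations form a finite set. *)
Notation adjacency n := {ffun 'I_n -> {ffun 'I_n -> bool}}.

Definition simple_graph (n : nat) (G : adjacency n) : bool :=
  [forall u, ~~ G u u] && [forall u, forall v, G u v == G v u].

Definition degree (n : nat) (G : adjacency n) (u : 'I_n) : nat :=
  #|[set v | G u v]|.

(* Defined for every vector of naturals, without the constraints of a degree
   sequence; it is empty when the vector has no realization. *)
Definition realizations (n : nat) (D : {ffun 'I_n -> nat}) :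
    {set adjacency n} :=
  [set G : adjacency n |
     simple_graph G && [forall u, degree G u == D u]].

Definition degree_sequence (n : nat) (D : {ffun 'I_n -> nat}) : bool :=
  [forall i, 0 < D i <= n - 1] && ~~ odd (\sum_(i < n) D i).

Definition graphic (n : nat) (D : {ffun 'I_n -> nat}) : Prop :=
  exists G : adjacency n, G \in realizations D.

Definition simple_region (n Sigma c1 c2 : nat) : {pred {ffun 'I_n -> nat}} :=
  [pred D : {ffun 'I_n -> nat} |
     [&& degree_sequence D,
         [forall i, c2 <= D i <= c1] &
         \sum_(i < n) D i == Sigma]].
Arguments simple_region : clear implicits.

Definition add_pair (n : nat) (D : {ffun 'I_n -> nat}) (i j : 'I_n) :
    {ffun 'I_n -> nat} :=
  [ffun k => D k + (k == i) + (k == j)].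

(* Meaningful only for graphic D: otherwise the denominator is 0. *)
Definition partial_pp (R : realType) (n : nat) (D : {ffun 'I_n -> nat}) : R :=
  (\sum_(i < n) \sum_(j < n | (i < j)%N)
     #|realizations (add_pair D i j)|%:R / #|realizations D|%:R)%R.

(* Main.v *)
(** Let [kappa] be the number of degrees [c1] in a sequence with entries in
    [{c1, c2}] and sum [Sigma], and let [x = kappa - c2], [y = c1 + 1 - kappa].
    The hypotheses say that [S = x y - c2 (n - 1 - c1)], the violation of the
    Erdos-Gallai inequality at [kappa], is at least
    [3/2 (r + 3) max (x, y)].  This slack pays for a Tyshkevich composition whose
    inner part is a half-graph on [2 t] vertices with [t - 1 >= r / 2]: [a]
    vertices form a clique joined to the half-graph, [b] vertices form an
    independent set, and the only freedom is an [a * b] bipartite graph between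
    them.  The half-graph is the same in every realization, while after adding
    one to the degrees of two of its vertices it can be replaced in at least
    [2 ^ (t - 1)] ways, whatever the rest of the realization is. *)
Require Import Defs.
From mathcomp Require Import all_boot all_order all_algebra.
From mathcomp Require Import all_fingroup zify ring lra.
From mathcomp Require Import reals exp.

Import Order.TTheory GRing.Theory Num.Theory.
Local Open Scope ring_scope.

(** * Real inequalities: from the hypotheses to an integer position with slack *)

(** With [s = sqrt Q], [Q - d^2 = (s - |d|) (s + |d|) >= eps s (s + |d|)]. As [s^2 >= beta L^2] and,
    because [beta <= 1], also [s >= beta L], this is at least [eps beta L (L + |d|)], where
    [eps beta L >= eps beta (L - 1) = 3 rho]. *)
Lemma discriminant_slack (R : realType) (L q beta eps d rho : R) :
  let Q := L ^+ 2 - 4 * q in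
  1 < L -> 0 <= q -> 0 < beta -> 0 < rho ->
  eps = 3 * rho / (beta * (L - 1)) ->
  4 * q <= (1 - beta) * L ^+ 2 ->
  `|d| <= (1 - eps) * Num.sqrt Q ->
  6 * rho * (L + `|d|) <= 2 * (Q - d ^+ 2).
Proof.
move=> Q L1 q0 b0 r0 epsE qle dle.
have L0 : 0 < L by lra.
have d0 := normr_ge0 d.
have d2 : d ^+ 2 = `|d| ^+ 2 by rewrite real_normK ?num_real.
move: (`|d|) d0 d2 dle => {}d' d0 -> dle.
have LL : 0 < L ^+ 2 by apply: exprn_gt0.
have b1 : beta <= 1 by nra.
have QL : beta * L ^+ 2 <= Q by rewrite /Q; lra.
have Q0 : 0 < Q by apply: lt_le_trans QL; rewrite mulr_gt0.
have s0 : 0 < Num.sqrt Q by rewrite sqrtr_gt0.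
have s2 : Num.sqrt Q ^+ 2 = Q by rewrite sqr_sqrtr ?ltW.
have eb : eps * beta * (L - 1) = 3 * rho.
  rewrite epsE; field; apply/andP; split; [lra|exact: lt0r_neq0].
have eps0 : 0 < eps by rewrite epsE divr_gt0 ?mulr_gt0 //; lra.
rewrite -s2; rewrite -s2 in QL; move: (Num.sqrt Q) s0 QL dle {s2} => s s0 QL dle.
have sL : beta * L <= s.
  have bL0 : 0 <= beta * L by rewrite ltW ?mulr_gt0.
  rewrite -(@ler_pXn2r _ 2) ?nnegrE ?(ltW s0) // exprMn.
  by apply: le_trans QL; rewrite ler_wpM2r ?(ltW LL) //; nra.
have h1 : eps * (s * (s + d')) <= s ^+ 2 - d' ^+ 2.
  have -> : s ^+ 2 - d' ^+ 2 = (s - d') * (s + d') by ring.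
  rewrite mulrA ler_wpM2r //; lra.
have h2 : beta * (L * (L + d')) <= s * (s + d') by nra.
have h3 : eps * (beta * (L * (L + d'))) <= eps * (s * (s + d')) by rewrite ler_pM2l.
have h4 : 3 * rho * (L + d') <= eps * beta * L * (L + d').
  rewrite ler_wpM2r ?addr_ge0 ?(ltW L0) // -eb ler_pM2l ?mulr_gt0 //; lra.
by lra.
Qed.

Lemma nearest_nat (R : realType) (x : R) :
  0 <= x -> exists k : nat, x - 2^-1 <= k%:R <= x + 2^-1.
Proof.
move=> x0; have y0 : 0 <= x + 2^-1 by lra.
exists (Num.trunc (x + 2^-1)).
have /andP[h1 h2] := Num.Theory.trunc_itv y0.
move: h1 h2; move: (Num.trunc _) => k h1; rewrite -[k.+1]addn1 natrD => h2.
by apply/andP; split; lra.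
Qed.

(** Let [L = c1 - c2 + 1] and let [d] be the deviation bounded in the hypothesis. Then [x + y = L]
    and [x - y = d], so [Q - d^2 = 4 S] and [L + |d| = 2 max (x, y)], and the discriminant bound
    becomes [3 rho max (x, y) <= 2 S]. The last two claims follow from [S <= x y] after division by
    [y] and by [x]. *)
Lemma core_slack (R : realType) (n c1 c2 Sigma rho beta : R) :
  0 < c2 -> c2 < c1 -> c1 + 1 <= n -> 0 < beta -> 0 < rho ->
  let Q := (c1 - c2 + 1) ^+ 2 - 4 * c2 * (n - 1 - c1) in
  let eps := 3 * rho / (beta * (c1 - c2)) in
  4 * c2 * (n - 1 - c1) <= (1 - beta) * (c1 - c2 + 1) ^+ 2 ->
  `|(Sigma - n * c2) / ((c1 - c2) / 2) - (1 + c1 + c2)|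
     <= (1 - eps) * Num.sqrt Q ->
  let kappa := (Sigma - n * c2) / (c1 - c2) in
  let x := kappa - c2 in
  let y := c1 + 1 - kappa in
  let S := x * y - c2 * (n - 1 - c1) in
  [/\ 3 * rho * x <= 2 * S, 3 * rho * y <= 2 * S,
      3 * rho <= 2 * x & 3 * rho <= 2 * y].
Proof.
move=> c20 c21 c1n b0 r0 Q eps qle dle kappa x y S.
pose L := c1 - c2 + 1.
pose q := c2 * (n - 1 - c1).
pose d := 2 * kappa - (1 + c1 + c2).
have L1 : 1 < L by rewrite /L; lra.
have q0 : 0 <= q by apply: mulr_ge0; lra.
have dE : (Sigma - n * c2) / ((c1 - c2) / 2) - (1 + c1 + c2) = d.
  by rewrite /d /kappa; field; rewrite gt_eqF //; lra.
have QE : L ^+ 2 - 4 * q = Q by rewrite /Q /L /q; ring.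
have slack : 6 * rho * (L + `|d|) <= 2 * (Q - d ^+ 2).
  rewrite -QE; apply: (@discriminant_slack _ _ _ beta eps); rewrite ?QE -?dE //.
  - by rewrite /eps; congr (_ / (_ * _)); rewrite /L; ring.
  - by rewrite mulrA.
have SE : 2 * (Q - d ^+ 2) = 8 * S by rewrite /S /x /y /Q /d; ring.
have xE : 2 * x = L + d by rewrite /x /L /d; ring.
have yE : 2 * y = L - d by rewrite /y /L /d; ring.
have Sxy : S <= x * y by rewrite lerBlDr lerDl.
rewrite {}SE in slack.
clear dE QE dle qle q0; clearbody S x y L d; clear Q eps kappa q.
have dx := ler_norm d; have dy := ler_norm (- d); rewrite normrN in dy.
have d0 := normr_ge0 d.
move: (`|d|) dx dy d0 slack => d' dx dy d0 slack.
have slack_of z : 2 * z <= L + d' -> 3 * rho * z <= 2 * S.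
  move=> z_le; have : 6 * rho * (2 * z) <= 6 * rho * (L + d').
    by apply: ler_wpM2l; lra.
  lra.
have Sx : 3 * rho * x <= 2 * S by apply: slack_of; lra.
have Sy : 3 * rho * y <= 2 * S by apply: slack_of; lra.
have S0 : 0 < S.
  have : 0 < 6 * rho * (L + d') by apply: mulr_gt0; lra.
  lra.
have x0 : 0 < x.
  rewrite ltNge; apply/negP => x_le0.
  have : x * y <= 0 by apply: mulr_le0_ge0; lra.
  lra.
have y0 : 0 < y.
  rewrite ltNge; apply/negP => y_le0.
  have : x * y <= 0 by apply: mulr_ge0_le0; lra.
  lra.
split=> //; first by rewrite -(ler_pM2r y0); lra.
by rewrite -(ler_pM2r x0); lra.
Qed.

(** Here [th] is a rounding error. Of the [3/2 rho x] guaranteed in [S], [rho x] covers [2 t x]; the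
    rest is at least [3/2 x] and covers the [th]-terms, which cost at most [x + t - 1/4]. The terms
    in [t] complete to [(t - 1)^2]. *)
Lemma rounded_slack (R : realType) (t rho x S th : R) :
  1 <= t -> 2 * t <= rho -> 3 <= rho ->
  3 * rho * x <= 2 * S -> 3 * rho <= 2 * x -> - 2^-1 <= th <= 2^-1 ->
  0 <= S - 2 * t * x + t ^+ 2 - t - th * (2 * x - 1 + 2 * t) - th ^+ 2.
Proof.
move=> t1 t_le rho3 S_ge x_ge /andP[th1 th2].
have th3 : 0 <= (2^-1 - th) * (2^-1 + th) by apply: mulr_ge0; lra.
have h1 : 0 <= (2^-1 - th) * (2 * x - 1 + 2 * t) by apply: mulr_ge0; lra.
have h2 : 0 <= (rho - 2 * t) * x by apply: mulr_ge0; lra.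
have h3 : 0 <= (rho - 3) * x by apply: mulr_ge0; lra.
have h4 : 0 <= (t - 1) ^+ 2 by apply: sqr_ge0.
lra.
Qed.

(* The clique size is [a = k - t] with [k] the integer nearest to [kappa].  The
   last two inequalities say, without subtraction, that the number [e] of
   clique-independent edges satisfies [b * c2 <= e <= a * (c1 + 1 - a - 2 * t)],
   where [b = n - a - 2 * t] and [e] is fixed by the degree sum. *)
Lemma core_position (R : realType) (n c1 c2 Sigma t : nat) (rho kappa : R) :
  (0 < t)%N -> 3 <= rho -> 2 * t%:R <= rho ->
  Sigma%:R = n%:R * c2%:R + kappa * (c1%:R - c2%:R) ->
  let x := kappa - c2%:R in
  let y := c1%:R + 1 - kappa in
  let S := x * y - c2%:R * (n%:R - 1 - c1%:R) in
  [/\ 3 * rho * x <= 2 * S, 3 * rho * y <= 2 * S,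
      3 * rho <= 2 * x & 3 * rho <= 2 * y] ->
  exists a : nat,
    [/\ (c2 <= a)%N, (a + 2 * t <= c1)%N,
        (a * a + 4 * a * t + 2 * t * t + 2 * n * c2
           <= Sigma + a + 2 * t + 2 * a * c2 + 4 * t * c2)%N &
        (Sigma + a * a + 2 * t <= a * (2 * c1 + 1) + 2 * t * t)%N].
Proof.
move=> t_gt0 rho3 t_le SigE x y S [Sx Sy x_ge y_ge].
have t1 : 1 <= t%:R :> R by rewrite ler1n.
have c20 : 0 <= c2%:R :> R by apply: ler0n.
have kappa0 : 0 <= kappa by rewrite /x in x_ge; lra.
have [k /andP[k1 k2]] := nearest_nat _ kappa kappa0.
have le_tk : (c2 + t <= k)%N by rewrite -(ler_nat R) natrD; rewrite /x in x_ge; lra.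
have [a def_k] : exists a, k = (a + t)%N.
  by exists (k - t)%N; rewrite subnK //; apply: leq_trans le_tk; apply: leq_addl.
rewrite def_k leq_add2r in le_tk; rewrite def_k natrD in k1 k2.
exists a.
pose th := a%:R + t%:R - kappa.
have th1 : - 2^-1 <= th <= 2^-1 by rewrite /th; apply/andP; split; lra.
have th2 : - 2^-1 <= - th <= 2^-1 by rewrite /th; apply/andP; split; lra.
(* Twice the slack in the upper bound on [e] is exactly the quantity in [F2]; for the lower bound it
   exceeds the quantity in [F1] by [2 t]. Exchanging [x] and [y] reverses the rounding, hence [- th]
   in [F2]. *)
have F1 := rounded_slack R _ _ _ _ _ t1 t_le rho3 Sx x_ge th1.
have F2 := rounded_slack R _ _ _ _ _ t1 t_le rho3 Sy y_ge th2.
split=> //; rewrite -(ler_nat R) !(natrD, natrM) ?SigE.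
- by rewrite /y in y_ge; lra.
- by move: F1; rewrite /S /x /y /th; lra.
- by move: F2; rewrite /S /x /y /th; lra.
Qed.

(** * Realizations, and adjacencies forced by vertex weights *)

Lemma degreeE (n : nat) (G : adjacency n) (u : 'I_n) :
  degree G u = (\sum_v G u v)%N.
Proof.
rewrite /degree -sum1_card big_mkcond /=.
by apply: eq_bigr => v _; rewrite inE; case: (G u v).
Qed.

Lemma realizationsP (n : nat) (D : {ffun 'I_n -> nat}) (G : adjacency n) :
  reflect [/\ forall u, G u u = false, forall u v, G u v = G v u &
              forall u, degree G u = D u]
          (G \in realizations D).
Proof.
rewrite inE; apply: (iffP idP).
  move=> /andP[/andP[/forallP Gi /forallP Gs] /forallP Gd]; split=> [u|u v|u].
  - exact/negbTE/Gi.
  - by have /forallP/(_ v)/eqP := Gs u.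
  - exact/eqP.
move=> [Gi Gs Gd]; apply/andP; split; first (apply/andP; split).
- by apply/forallP => u; rewrite Gi.
- by apply/forallP => u; apply/forallP => v; rewrite Gs.
- by apply/forallP => u; rewrite Gd.
Qed.

(* [\sum_(u, v) (w u + w v) * (G u v - G' u v)] vanishes because both graphs
   have the same degrees, and each of its terms is nonnegative. *)
Lemma weight_rigidity (n : nat) (D : {ffun 'I_n -> nat}) (w : 'I_n -> int)
    (G G' : adjacency n) :
  G \in realizations D -> G' \in realizations D ->
  (forall u v, u != v -> 0 < w u + w v -> G u v) ->
  (forall u v, u != v -> w u + w v < 0 -> ~~ G u v) ->
  forall u v, u != v -> w u + w v != 0 -> G' u v = G u v.
Proof.
move=> /realizationsP[Gi Gs Gd] /realizationsP[Gi' Gs' Gd'] Gpos Gneg.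
pose F u v : int := (w u + w v) * ((G u v)%:R - (G' u v)%:R).
have F_ge0 u v : 0 <= F u v.
  rewrite /F; case: (eqVneq u v) => [->|neq_uv]; first by rewrite Gi Gi' subrr mulr0.
  case: (ltgtP 0 (w u + w v)) => [w_gt0|w_lt0|<-]; last by rewrite mul0r.
    by apply: mulr_ge0; [exact: ltW | rewrite Gpos // subr_ge0; case: (G' u v)].
  apply: mulr_le0; first exact: ltW.
  by rewrite (negbTE (Gneg _ _ _ _)) // sub0r oppr_le0; case: (G' u v).
have half : \sum_u \sum_v w u * ((G u v)%:R - (G' u v)%:R) = 0 :> int.
  apply: big1 => u _; rewrite -mulr_sumr sumrB -!natr_sum -!degreeE Gd Gd'.
  by rewrite subrr mulr0.
have F_sum : \sum_u \sum_v F u v = 0.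
  under eq_bigr => u _ do (under eq_bigr => v _ do rewrite /F mulrDl; rewrite big_split).
  rewrite big_split /= half add0r exchange_big /= -[RHS]half.
  by apply: eq_bigr => v _; apply: eq_bigr => u _; rewrite Gs Gs'.
move=> u v neq_uv w_neq0.
have /eqP := F_sum; rewrite psumr_eq0 => [/allP/(_ u)|u' _]; last exact: sumr_ge0.
rewrite mem_index_enum => /(_ isT); rewrite psumr_eq0 // => /allP/(_ v).
rewrite mem_index_enum => /(_ isT); rewrite /F /= mulf_eq0 (negbTE w_neq0) /=.
by case: (G u v); case: (G' u v).
Qed.

(** * Replacing a half-graph in [2 ^ t] ways *)

(** Induction on the number [m] of steps, all positions beyond [m] being still fixed. Exchanging the
    values at [m] and [m.+1] doubles the set: position [m] receives [m.+1], and position [m.+1] a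
    value at most [m.+1]. *)
Lemma card_perm_le_succ (t : nat) :
  exists P : {set 'S_t.+1},
    #|P| = (2 ^ t)%N /\ forall s i, s \in P -> (s i <= i.+1)%N.
Proof.
have main m : (m <= t)%N -> exists P : {set 'S_t.+1},
    [/\ #|P| = (2 ^ m)%N, forall s i, s \in P -> (s i <= i.+1)%N
      & forall s (i : 'I_t.+1), s \in P -> (m < i)%N -> s i = i]; last first.
  by have [P [cP leP _]] := main t (leqnn t); exists P.
elim: m => [_|m IHm lt_mt].
  exists [set 1%g]; split; first by rewrite cards1 expn0.
    by move=> s i /set1P->; rewrite perm1.
  by move=> s i /set1P->; rewrite perm1.
have [P [cP leP fixP]] := IHm (ltnW lt_mt).
pose i0 : 'I_t.+1 := inord m; pose i1 : 'I_t.+1 := inord m.+1.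
have vi0 : i0 = m :> nat by rewrite inordK // ltnS ltnW.
have vi1 : i1 = m.+1 :> nat by rewrite inordK // ltnS.
have fix1 s : s \in P -> s i1 = i1 by move=> sP; apply: fixP => //; rewrite vi1.
exists (P :|: [set (tperm i0 i1 * s)%g | s in P]); split.
- rewrite cardsU (_ : P :&: _ = set0) ?cards0 ?subn0.
    by rewrite card_imset ?cP ?addnn -?mul2n ?expnS //; apply: mulgI.
  (* The old permutations fix [m.+1], the new ones do not. *)
  apply/setP => s; rewrite !inE; apply/negbTE/negP => /andP[sP /imsetP[s' s'P defs]].
  have := fix1 _ sP; rewrite defs permM tpermR -[in RHS](fix1 _ s'P) => /perm_inj.
  by move/(congr1 val) => /=; rewrite vi0 vi1; lia.
- move=> s i /setUP[/leP //|/imsetP[s' s'P ->]].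
  rewrite permM; case: tpermP => [->|->|_ _]; last exact: leP.
    by rewrite fix1 // vi1 vi0.
  by apply: leq_trans (leP _ _ s'P) _; rewrite vi0 vi1.
- move=> s i /setUP[sP|/imsetP[s' s'P ->]] lt_mi; first by apply: fixP => //; apply: ltnW.
  rewrite permM tpermD ?fixP //; first exact: ltnW.
  + by apply/eqP => /(congr1 val) /=; rewrite vi0; lia.
  + by apply/eqP => /(congr1 val) /=; rewrite vi1; lia.
Qed.

Section HalfGraph.

Variables (n t : nat) (v w : 'I_t.+1 -> 'I_n).
Hypotheses (v_inj : injective v) (w_inj : injective w).
Hypothesis vw_neq : forall i j, v i != w j.

Definition preimage (f : 'I_t.+1 -> 'I_n) (x : 'I_n) := [pick i | f i == x].

Lemma preimageK (f : 'I_t.+1 -> 'I_n) (i : 'I_t.+1) :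
  injective f -> preimage f (f i) = Some i.
Proof.
move=> f_inj; rewrite /preimage; case: pickP => [j /eqP/f_inj -> //|/(_ i)].
by rewrite eqxx.
Qed.

Lemma preimage_none (f : 'I_t.+1 -> 'I_n) (x : 'I_n) :
  (preimage f x == None) = (x \notin codom f).
Proof.
rewrite /preimage; case: pickP => [i /eqP <-|f_x]; first by rewrite codom_f.
by apply/esym/codomP => -[i def_x]; have := f_x i; rewrite def_x eqxx.
Qed.

Let preimage_vw i : preimage v (w i) = None.
Proof.
apply/eqP; rewrite preimage_none; apply/codomP => -[j /eqP].
by rewrite eq_sym (negbTE (vw_neq _ _)).
Qed.

Let preimage_wv i : preimage w (v i) = None.
Proof.
apply/eqP; rewrite preimage_none; apply/codomP => -[j /eqP].
by rewrite (negbTE (vw_neq _ _)).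
Qed.

(** Surgery on the block between the [v i] and the [w j], in both orientations of an edge; pairs
    inside either side are left alone. *)
Definition patch (M : 'I_t.+1 -> 'I_t.+1 -> bool) (G : adjacency n) :
    adjacency n :=
  [ffun x => [ffun y =>
    match preimage v x, preimage w y, preimage w x, preimage v y with
    | Some i, Some j, _, _ => M i j
    | _, _, Some j, Some i => M i j
    | _, _, _, _ => G x y
    end]].

Lemma patch_vw (M : 'I_t.+1 -> 'I_t.+1 -> bool) (G : adjacency n) i j :
  patch M G (v i) (w j) = M i j.
Proof. by rewrite !ffunE !preimageK. Qed.

Lemma patch_wv (M : 'I_t.+1 -> 'I_t.+1 -> bool) (G : adjacency n) i j :
  patch M G (w j) (v i) = M i j.
Proof. by rewrite !ffunE !preimageK // preimage_vw. Qed.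

Lemma patch_v (M : 'I_t.+1 -> 'I_t.+1 -> bool) (G : adjacency n) i y :
  y \notin codom w -> patch M G (v i) y = G (v i) y.
Proof. by rewrite -preimage_none !ffunE preimage_wv preimageK // => /eqP->. Qed.

Lemma patch_w (M : 'I_t.+1 -> 'I_t.+1 -> bool) (G : adjacency n) j y :
  y \notin codom v -> patch M G (w j) y = G (w j) y.
Proof. by rewrite -preimage_none !ffunE preimage_vw preimageK // => /eqP->. Qed.

Lemma patch_out (M : 'I_t.+1 -> 'I_t.+1 -> bool) (G : adjacency n) x y :
  x \notin codom v -> x \notin codom w -> patch M G x y = G x y.
Proof. by rewrite -!preimage_none !ffunE => /eqP-> /eqP->. Qed.

Lemma patch_sym (M : 'I_t.+1 -> 'I_t.+1 -> bool) (G : adjacency n) :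
  (forall x y, G x y = G y x) -> forall x y, patch M G x y = patch M G y x.
Proof.
move=> Gs x y; have [/codomP[i ->]|vx] := boolP (x \in codom v).
  have [/codomP[j ->]|wy] := boolP (y \in codom w).
    by rewrite patch_vw patch_wv.
  rewrite patch_v //; have [/codomP[j ->]|vy] := boolP (y \in codom v).
    by rewrite patch_v -?preimage_none ?preimage_wv.
  by rewrite patch_out.
have [/codomP[j ->]|wx] := boolP (x \in codom w).
  have [/codomP[i ->]|vy] := boolP (y \in codom v).
    by rewrite patch_vw patch_wv.
  rewrite patch_w //; have [/codomP[i ->]|wy] := boolP (y \in codom w).
    by rewrite patch_w -?preimage_none ?preimage_vw.
  by rewrite patch_out.
rewrite patch_out //; have [/codomP[i ->]|vy] := boolP (y \in codom v).
  by rewrite patch_v.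
have [/codomP[i ->]|wy] := boolP (y \in codom w); first by rewrite patch_w.
by rewrite patch_out.
Qed.

Lemma sum_codom_split (f : 'I_t.+1 -> 'I_n) (F : 'I_n -> nat) :
  injective f ->
  (\sum_y F y = \sum_i F (f i) + \sum_(y | y \notin codom f) F y)%N.
Proof.
move=> f_inj; rewrite (bigID (mem (codom f))) /=; congr addn.
rewrite -big_uniq /=; last by rewrite codomE map_inj_uniq ?enum_uniq.
by rewrite codomE big_map big_enum.
Qed.

(* The half-graph matrix [i < j] with its superdiagonal replaced by the
   permutation matrix of [s].  When [s i <= i.+1] the two do not overlap, and
   all line sums are kept but those of the last row and first column, which
   grow by one. *)
Definition hessenberg (s : 'S_t.+1) (i j : 'I_t.+1) : bool :=
  (i.+1 < j)%N || (j == s i).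

Lemma hessenbergE (s : 'S_t.+1) (i j : 'I_t.+1) :
  (forall k, s k <= k.+1)%N ->
  hessenberg s i j = ((i.+1 < j) + (j == s i))%N :> nat.
Proof.
move=> s_le; rewrite /hessenberg; case: eqP => [->|_]; last by rewrite orbF addn0.
by have:= s_le i; lia.
Qed.

Lemma ltn_sum_split (i j : 'I_t.+1) :
  ((i < j)%N = (i.+1 < j)%N + (i.+1 == j :> nat) :> nat)%N.
Proof. by lia. Qed.

(** The permutation gives one to every row, while the superdiagonal that it replaces gives one to
    every row but the last. *)
Lemma hessenberg_row (s : 'S_t.+1) (i : 'I_t.+1) :
  (forall k, s k <= k.+1)%N ->
  (\sum_j hessenberg s i j = \sum_(j < t.+1) (i < j) + (i == ord_max))%N.
Proof.
move=> s_le; under eq_bigr => j _ do rewrite hessenbergE //.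
under [in RHS]eq_bigr => j _ do rewrite ltn_sum_split.
rewrite !big_split -addnA; congr addn.
rewrite (bigD1 (s i)) //= eqxx big1 ?addn0; last by move=> j /negbTE->.
have [->|ne_i] := eqVneq i ord_max.
  by rewrite big1 // => j _; have := ltn_ord j; rewrite /=; lia.
have lt_it : (i.+1 < t.+1)%N.
  by have := ltn_ord i; have : i != t :> nat by []; lia.
rewrite (bigD1 (Ordinal lt_it)) //= eqxx big1 // => j; rewrite -val_eqE /=; lia.
Qed.

Lemma hessenberg_col (s : 'S_t.+1) (j : 'I_t.+1) :
  (forall k, s k <= k.+1)%N ->
  (\sum_i hessenberg s i j = \sum_(i < t.+1) (i < j) + (j == ord0))%N.
Proof.
move=> s_le; under eq_bigr => i _ do rewrite hessenbergE //.
under [in RHS]eq_bigr => i _ do rewrite ltn_sum_split.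
rewrite !big_split -addnA; congr addn.
rewrite (bigD1 (s^-1%g j)) //= permKV eqxx big1 ?addn0; last first.
  by move=> i ne_i; case: eqP => // def_j; rewrite def_j permK eqxx in ne_i.
have [->|ne_j] := eqVneq j ord0; first by rewrite big1.
have j_gt0 : (0 < j)%N by rewrite lt0n.
have lt_jt : (j.-1 < t.+1)%N by have := ltn_ord j; lia.
rewrite (bigD1 (Ordinal lt_jt)) //= prednK // eqxx big1 // => i; rewrite -val_eqE /=; lia.
Qed.

(** Pairs of a permutation and a realization of [D] are mapped injectively to realizations of the
    increased sequence, by patching the half-graph block with the matrix of the permutation. *)
Lemma half_graph_growth (D : {ffun 'I_n -> nat}) :
  (forall G, G \in realizations D -> forall i j, G (v i) (w j) = (i < j)%N) ->
  (2 ^ t * #|realizations D| <=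
     #|realizations (Defs.add_pair D (v ord_max) (w ord0))|)%N.
Proof.
move=> Ghalf; have [P [<- P_le]] := card_perm_le_succ t.
rewrite -cardsX.
pose f (x : 'S_t.+1 * adjacency n) := patch (hessenberg x.1) x.2.
have f_inj : {in setX P (realizations D) &, injective f}.
  move=> [s G] [s' G'] /setXP[/= sP GD] /setXP[/= s'P GD'] eq_f.
  have eq_s : s = s'.
    (* The patched block determines [s]: its entry at [(i, s i)] is true, and [s i <= i.+1] leaves
       only [s' i = s i] as the cause. *)
    apply/permP => i; have : hessenberg s i (s i) by rewrite /hessenberg eqxx orbT.
    rewrite -(patch_vw _ G) -[patch _ _]/(f (s, G)) eq_f patch_vw /hessenberg.
    by rewrite ltnNge P_le // => /eqP.
  (* Outside the block the patch keeps [G]; inside it both graphs are the half-graph. *)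
  congr pair => //; apply/ffunP => x; apply/ffunP => y.
  have [_ Gs _] := realizationsP _ _ _ GD; have [_ Gs' _] := realizationsP _ _ _ GD'.
  have eq_f_xy : f (s, G) x y = f (s', G') x y by rewrite eq_f.
  rewrite /f /= in eq_f_xy.
  have [/codomP[i def_x]|vx] := boolP (x \in codom v).
    have [/codomP[j ->]|wy] := boolP (y \in codom w); first by rewrite def_x !Ghalf.
    by move: eq_f_xy; rewrite def_x !patch_v.
  have [/codomP[j def_x]|wx] := boolP (x \in codom w).
    have [/codomP[i ->]|vy] := boolP (y \in codom v).
      by rewrite def_x Gs Gs' !Ghalf.
    by move: eq_f_xy; rewrite def_x !patch_w.
  by move: eq_f_xy; rewrite !patch_out.
rewrite -(card_in_imset f_inj); apply/subset_leq_card/subsetP.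
move=> _ /imsetP[[s G] /setXP[/= sP GD] ->].
rewrite /f /=.
have s_le k := P_le s k sP; have [Gi Gs Gd] := realizationsP _ _ _ GD.
apply/realizationsP; split=> [x||x]; last 1 first.
- rewrite [RHS]ffunE -Gd !degreeE.
  have [/codomP[i ->]|vx] := boolP (x \in codom v).
    rewrite (inj_eq v_inj) (negbTE (vw_neq _ _)) addn0.
    rewrite !(sum_codom_split _ _ w_inj).
    under eq_bigr => j _ do rewrite patch_vw.
    rewrite hessenberg_row // addnAC; congr (_ + _ + _)%N.
      by apply: eq_bigr => j _; rewrite Ghalf.
    by apply: eq_bigr => y wy; rewrite patch_v.
  have [/codomP[j ->]|wx] := boolP (x \in codom w).
    rewrite (inj_eq w_inj) eq_sym (negbTE (vw_neq _ _)) addn0.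
    rewrite !(sum_codom_split _ _ v_inj).
    under eq_bigr => i _ do rewrite patch_wv.
    rewrite hessenberg_col // addnAC; congr (_ + _ + _)%N.
      by apply: eq_bigr => i _; rewrite Gs Ghalf.
    by apply: eq_bigr => y vy; rewrite patch_w.
  have -> : x == v ord_max = false by apply: contraNF vx => /eqP->; apply: codom_f.
  have -> : x == w ord0 = false by apply: contraNF wx => /eqP->; apply: codom_f.
  by rewrite !addn0; apply: eq_bigr => y _; rewrite patch_out.
- have [/codomP[i ->]|vx] := boolP (x \in codom v).
    by rewrite patch_v // -preimage_none preimage_wv.
  have [/codomP[j ->]|wx] := boolP (x \in codom w).
    by rewrite patch_w // -preimage_none preimage_vw.
  by rewrite patch_out.
- exact: patch_sym.
Qed.

End HalfGraph.

(** * A bipartite graph with bounded rows and balanced columns *)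

Local Open Scope nat_scope.

(* The edge number [m < e] joins the row [m %/ p] to the column [m %% b], so
   that rows are filled in turn with at most [p] edges each and column degrees
   are balanced. *)
Definition cyclic_biadjacency (e p b i j : nat) : bool :=
  has (fun m => (m %/ p == i) && (m %% b == j)) (iota 0 e).

Lemma sum_pred1_ltn (e k : nat) : \sum_(i < e) (i == k :> nat) = (k < e).
Proof.
have [lt_ke|le_ek] := ltnP k e.
  rewrite (bigD1 (Ordinal lt_ke)) //= eqxx big1 // => i.
  by rewrite -val_eqE /= => /negbTE->.
by rewrite big1 // => i _; have := ltn_ord i; lia.
Qed.

(** No cell is hit twice: two edge numbers in one row differ by less than [p <= b], so they are
    equal if congruent modulo [b]. *)
Lemma cyclic_biadjacencyE (e p b i j : nat) : 0 < p <= b ->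
  cyclic_biadjacency e p b i j
    = \sum_(m < e) ((m %/ p == i) && (m %% b == j)) :> nat.
Proof.
move=> /andP[p_gt0 le_pb].
have [/hasP[m]|/hasPn none] := boolP (cyclic_biadjacency e p b i j); last first.
  by rewrite big1 // => m _; rewrite (negbTE (none _ _)) // mem_iota /=.
rewrite mem_iota /= => lt_me /andP[/eqP mi /eqP mj].
rewrite (bigD1 (Ordinal lt_me)) //= mi mj !eqxx big1 // => m'.
rewrite -val_eqE /= => ne_m'; case: eqP => //= m'i; case: eqP => //= m'j.
case/eqP: ne_m'.
have := divn_eq m p; have := divn_eq m' p; rewrite mi m'i.
have := ltn_pmod m p_gt0; have := ltn_pmod m' p_gt0.
have := divn_eq m b; have := divn_eq m' b; rewrite mj m'j.
move: (m' %/ b) (m %/ b) (m' %% p) (m %% p) => u v u' v'.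
move=> mE m'E u'p v'p mE' m'E'.
have [uv|uv|uv] := ltngtP u v; last by rewrite mE m'E uv.
  have : u.+1 * b <= v * b by rewrite leq_mul2r uv orbT.
  by rewrite mulSn; lia.
have : v.+1 * b <= u * b by rewrite leq_mul2r uv orbT.
by rewrite mulSn; lia.
Qed.

Lemma cyclic_biadjacency_total (e p a b : nat) : 0 < p <= b -> e <= a * p ->
  \sum_(i < a) \sum_(j < b) cyclic_biadjacency e p b i j = e.
Proof.
move=> p_bnd le_e.
under eq_bigr => i _ do under eq_bigr => j _ do rewrite cyclic_biadjacencyE //.
under eq_bigr => i _ do rewrite exchange_big /=.
rewrite exchange_big /= -[RHS]card_ord -sum1_card; apply: eq_bigr => m _.
under eq_bigr => i _ do (under eq_bigr => j _ do rewrite -mulnb eq_sym (eq_sym (m %% b))).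
under eq_bigr => i _ do rewrite -big_distrr /= sum_pred1_ltn.
rewrite -big_distrl /= sum_pred1_ltn ltn_mod ltn_divLR; last by case/andP: p_bnd.
by have -> : m < a * p by [apply: leq_trans le_e]; case/andP: p_bnd; lia.
Qed.

Lemma cyclic_biadjacency_row (e p b i : nat) : 0 < p <= b ->
  \sum_(j < b) cyclic_biadjacency e p b i j <= p.
Proof.
move=> p_bnd.
under eq_bigr => j _ do rewrite cyclic_biadjacencyE //.
rewrite exchange_big /=.
have : \sum_(m < e) \sum_(j < b) ((m %/ p == i) && (m %% b == j))
   <= \sum_(m < e) (m %/ p == i).
  apply: leq_sum => m _; under eq_bigr => j _ do rewrite -mulnb (eq_sym (m %% b)).
  by rewrite -big_distrr /= sum_pred1_ltn; case: (_ < b); rewrite ?muln1 ?muln0.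
move/leq_trans; apply.
have p_gt0 : 0 < p by case/andP: p_bnd.
rewrite (_ : \sum_(m < e) _ = #|[set m : 'I_e | m %/ p == i]|); last first.
  by rewrite -sum1_card [RHS]big_mkcond /=; apply: eq_bigr => m _; rewrite inE; case: eqP.
rewrite -[p in _ <= p]card_ord.
rewrite -(@card_in_imset _ _ (fun m : 'I_e => Ordinal (ltn_pmod m p_gt0))).
  exact: max_card.
move=> m m'; rewrite !inE => /eqP mi /eqP m'i [] eq_mod; apply: val_inj.
by rewrite /= (divn_eq m p) (divn_eq m' p) mi m'i eq_mod.
Qed.

(** The numbers [q * b + j] with [q < c] all lie below [b * c <= e] and fall in column [j];
    [e <= a * p] keeps them in rows below [a]. *)
Lemma cyclic_biadjacency_col (e p a b c j : nat) :
  0 < p <= b -> e <= a * p -> b * c <= e -> j < b ->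
  c <= \sum_(i < a) cyclic_biadjacency e p b i j.
Proof.
move=> p_bnd le_e le_bc lt_jb.
have p_gt0 : 0 < p by case/andP: p_bnd.
under eq_bigr => i _ do rewrite cyclic_biadjacencyE //.
rewrite exchange_big /=.
have -> : \sum_(m < e) \sum_(i < a) ((m %/ p == i) && (m %% b == j))
   = #|[set m : 'I_e | m %% b == j]|.
  rewrite -sum1_card [RHS]big_mkcond /=; apply: eq_bigr => m _; rewrite inE.
  under eq_bigr => i _ do rewrite -mulnb eq_sym.
  rewrite -big_distrl /= sum_pred1_ltn ltn_divLR // (leq_trans (ltn_ord m)) // mul1n.
  by case: eqP.
have lt_f (q : 'I_c) : q * b + j < e.
  apply: leq_trans le_bc; have : q.+1 * b <= c * b by rewrite leq_mul2r ltn_ord orbT.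
  by rewrite mulSn mulnC; lia.
rewrite -[c in c <= _]card_ord -(@card_imset _ _ (fun q => Ordinal (lt_f q))).
  apply/subset_leq_card/subsetP => _ /imsetP[q _ ->].
  by rewrite inE /= modnMDl modn_small.
move=> q q' [] /eqP; rewrite eqn_add2r eqn_mul2r => /orP[/eqP b0|/eqP/val_inj //].
by rewrite b0 in lt_jb.
Qed.

(** * The composed graph and its degrees *)

(* The vertices below [a] are the clique, those from [a + 2 * t] on are the
   independent set.  The half-graph between them is written as the threshold
   graph [x + y < 2 * t - 1] on [x = u - a], [y = v - a]; the resulting
   condition on [u + v] is also right for all other pairs, except those
   between the clique and the independent set. *)
Definition composed_adj (e p b a t u v : nat) : bool :=
  (u != v) &&
  (if (u < a) && (a + 2 * t <= v)
   then cyclic_biadjacency e p b u (v - (a + 2 * t))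
   else if (v < a) && (a + 2 * t <= u)
   then cyclic_biadjacency e p b v (u - (a + 2 * t))
   else (u + v).+1 < a + (a + 2 * t)).

Lemma composed_adj_sym (e p b a t u v : nat) :
  composed_adj e p b a t u v = composed_adj e p b a t v u.
Proof.
rewrite /composed_adj eq_sym (addnC u); congr andb.
by do 2 case: ifP => //; lia.
Qed.

Definition composed_graph (e p b a t : nat) : adjacency (a + 2 * t + b) :=
  [ffun u : 'I__ => [ffun v : 'I__ => composed_adj e p b a t u v]].

Lemma sum_ord_add (m k : nat) (F : nat -> nat) :
  \sum_(i < m + k) F i = \sum_(i < m) F i + \sum_(j < k) F (m + j).
Proof. by rewrite big_split_ord. Qed.

(** Counts the neighbours in a threshold graph; the added term restores the excluded loop at [u]. *)
Lemma sum_neq_ltn (m u k : nat) :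
  \sum_(v < m) ((u != v) && (v < k)) + (u < minn m k) = minn m k.
Proof.
elim: m => [|m IHm]; first by rewrite big_ord0 min0n.
rewrite big_ord_recr /=; move: IHm; move: (\sum_(v < m) _) => s.
have [lt_mk|le_km] := ltnP m k.
  by rewrite (minn_idPl lt_mk) andbT; lia.
by rewrite (minn_idPr (leqW le_km)) andbF addn0.
Qed.

Lemma sum_ord_double (m : nat) : 2 * (\sum_(i < m) i) + m = m * m.
Proof.
elim: m => [|m IHm]; first by rewrite big_ord0.
by rewrite big_ord_recr /=; move: IHm; move: (\sum_(i < m) _) => s; lia.
Qed.

Section ComposedDegrees.

Variables e p b a t : nat.

Local Notation deg u := (\sum_(v < a + 2 * t + b) composed_adj e p b a t u v).

Lemma composed_degree_clique (u : nat) : u < a ->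
  deg u + 1 = a + 2 * t + \sum_(j < b) cyclic_biadjacency e p b u j.
Proof.
move=> lt_ua; rewrite (sum_ord_add _ _ (composed_adj e p b a t u)) addnAC.
congr addn; last first.
  apply: eq_bigr => j _; rewrite /composed_adj lt_ua leq_addr /= addKn.
  by rewrite (_ : u != _) //; lia.
have := sum_neq_ltn (a + 2 * t) u (a + 2 * t); rewrite minnn.
rewrite (_ : u < a + 2 * t = true); last by lia.
move=> sum_N; rewrite -[RHS]sum_N; congr addn.
apply: eq_bigr => v _; congr nat_of_bool.
have := ltn_ord v; rewrite /composed_adj => lt_v.
by rewrite [_ <= v]leqNgt lt_v [_ <= u]leqNgt (_ : u < a + 2 * t) ?andbF //=; lia.
Qed.

(** The neighbours of [a + x] are the vertices below [a + 2 * t - x.+1] except itself, and it lies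
    below that bound exactly when [x < t]. *)
Lemma composed_degree_core (x : nat) : x < 2 * t ->
  deg (a + x) + (x < t) + x + 1 = a + 2 * t.
Proof.
move=> lt_x; rewrite (sum_ord_add _ _ (composed_adj e p b a t (a + x))).
rewrite (_ : \sum_(j < b) _ = 0) ?addn0; last first.
  apply: big1 => j _; rewrite /composed_adj; case: ifP => [|_]; first by lia.
  by case: ifP => [|_]; lia.
have := sum_neq_ltn (a + 2 * t) (a + x) (a + 2 * t - x.+1).
under eq_bigr => v _.
  have -> : (a + x != v) && (v < a + 2 * t - x.+1) = composed_adj e p b a t (a + x) v.
    have := ltn_ord v; rewrite /composed_adj => lt_v; congr andb.
    by rewrite [_ <= v]leqNgt lt_v [_ <= a + x]leqNgt (_ : a + x < a + 2 * t) ?andbF /=; lia.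
  over.
move: (\sum_(v < _) _) => s; lia.
Qed.

Lemma composed_degree_stable (j : nat) : j < b ->
  deg (a + 2 * t + j) = \sum_(i < a) cyclic_biadjacency e p b i j.
Proof.
move=> lt_jb; rewrite -[a + 2 * t + b]addnA.
rewrite (sum_ord_add _ _ (composed_adj e p b a t (a + 2 * t + j))).
rewrite [X in _ + X]big1 ?addn0; last first.
  move=> v _; rewrite /composed_adj; case: ifP => [|_]; first by lia.
  by case: ifP => [|_]; lia.
apply: eq_bigr => i _; have := ltn_ord i; rewrite /composed_adj => lt_i.
rewrite ifN; last by lia.
rewrite lt_i leq_addr /= addKn (_ : _ != _) //; lia.
Qed.

Lemma composed_degree_sum : 0 < p <= b -> e <= a * p ->
  \sum_(u < a + 2 * t + b) deg u + a + 2 * t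
    = a * a + 4 * a * t + 2 * t * t + 2 * e.
Proof.
move=> p_bnd le_e; rewrite (sum_ord_add _ _ (fun u => deg u)).
rewrite (sum_ord_add _ _ (fun u => deg u)).
have clique : \sum_(u < a) deg u + a = a * (a + 2 * t) + e.
  rewrite -[X in _ + X = _]card_ord -sum1_card -big_split /=.
  under eq_bigr => u _ do rewrite composed_degree_clique //.
  by rewrite big_split /= sum_nat_const card_ord cyclic_biadjacency_total.
have core : \sum_(x < 2 * t) deg (a + x) + t + \sum_(x < 2 * t) x + 2 * t
    = 2 * t * (a + 2 * t).
  have -> : \sum_(x < 2 * t) deg (a + x) + t + \sum_(x < 2 * t) x + 2 * t
      = \sum_(x < 2 * t) (deg (a + x) + (x < t) + x + 1).
    rewrite !big_split /= sum1_card card_ord; congr (_ + _ + _ + _).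
    have := sum_neq_ltn (2 * t) (2 * t) t.
    rewrite (_ : minn _ _ = t); last by lia.
    rewrite (_ : 2 * t < t = false) ?addn0; last by lia.
    move=> def_t; rewrite -[LHS]def_t; apply: eq_bigr => x _.
    by have := ltn_ord x; lia.
  under eq_bigr => x _ do rewrite composed_degree_core //.
  by rewrite sum_nat_const card_ord.
have stable : \sum_(j < b) deg (a + 2 * t + j) = e.
  under eq_bigr => j _ do rewrite composed_degree_stable //.
  by rewrite exchange_big /= cyclic_biadjacency_total.
have := sum_ord_double (2 * t).
rewrite stable; move: clique core.
move: (\sum_(x < 2 * t) x) (\sum_(u < a) _) => X A.
move: (\sum_(x < 2 * t) _) => C; lia.
Qed.

(** The choice of [p] caps clique degrees at [a + 2 t - 1 + p = c1]. Core degrees lie between [a]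
    and [a + 2 t - 2]. Independent vertices have degree at most [a], and at least [c2] because the
    columns are balanced. *)
Lemma composed_degree_bounds (c1 c2 u : nat) :
  0 < t -> p + (a + 2 * t) = c1.+1 -> 0 < p <= b -> e <= a * p -> b * c2 <= e ->
  c2 <= a -> u < a + 2 * t + b -> c2 <= deg u <= c1.
Proof.
move=> t_gt0 def_p p_bnd le_e ge_e le_c2a lt_u.
have [lt_ua|le_au] := ltnP u a.
  have := composed_degree_clique u lt_ua.
  have := cyclic_biadjacency_row e p b u p_bnd.
  move: (\sum_(j < b) _) => row; move: (\sum_(v < _) _) => d; lia.
have [lt_ut|le_tu] := ltnP u (a + 2 * t).
  have lt_x : u - a < 2 * t by lia.
  have := composed_degree_core _ lt_x; rewrite subnKC //.
  move: (\sum_(v < _) _) => d; lia.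
have lt_j : u - (a + 2 * t) < b by lia.
have := composed_degree_stable _ lt_j; rewrite subnKC // => ->.
rewrite (cyclic_biadjacency_col _ _ _ _ _ _ p_bnd le_e ge_e lt_j) /=.
apply: (@leq_trans a); last by lia.
rewrite -[X in _ <= X]card_ord -sum1_card; apply: leq_sum => i _; exact: leq_b1.
Qed.

End ComposedDegrees.

(** * Rigidity of the half-graph inside the composition *)

(* [composed_weight u + composed_weight v] is zero between the clique and the
   independent set, and elsewhere its sign decides adjacency. *)
Definition composed_weight (a t u : nat) : int :=
  if u < a then Posz (4 * t)
  else if u < a + 2 * t then (Posz (4 * t) - 3 - Posz (4 * (u - a)))%R
  else (- Posz (4 * t))%R.

Lemma composed_weight_gt0 (e p b a t u v : nat) : u != v ->
  (0 < composed_weight a t u + composed_weight a t v)%R ->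
  composed_adj e p b a t u v.
Proof.
rewrite /composed_weight /composed_adj => -> /=.
case: (ltnP u a) => ua; case: (ltnP v a) => va;
case: (ltnP u (a + 2 * t)) => ut; case: (ltnP v (a + 2 * t)) => vt /=; lia.
Qed.

Lemma composed_weight_lt0 (e p b a t u v : nat) : u != v ->
  (composed_weight a t u + composed_weight a t v < 0)%R ->
  ~~ composed_adj e p b a t u v.
Proof.
rewrite /composed_weight /composed_adj => -> /=.
case: (ltnP u a) => ua; case: (ltnP v a) => va;
case: (ltnP u (a + 2 * t)) => ut; case: (ltnP v (a + 2 * t)) => vt /=; lia.
Qed.

Definition composed_degrees (e p b a t : nat) :
    {ffun 'I_(a + 2 * t + b) -> nat} :=
  [ffun u => degree (composed_graph e p b a t) u].

Lemma composed_degreesE (e p b a t : nat) (u : 'I_(a + 2 * t + b)) :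
  composed_degrees e p b a t u
    = \sum_(v < a + 2 * t + b) composed_adj e p b a t u v.
Proof. by rewrite ffunE degreeE; apply: eq_bigr => v _; rewrite !ffunE. Qed.

Lemma composed_realization (e p b a t : nat) :
  composed_graph e p b a t \in realizations (composed_degrees e p b a t).
Proof.
apply/realizationsP; split=> [u|u v|u]; last by rewrite ffunE.
  by rewrite !ffunE /composed_adj eqxx.
by rewrite !ffunE composed_adj_sym.
Qed.

Lemma composed_growth (e p b a t : nat) :
  exists i j : 'I_(a + 2 * t.+1 + b),
    i < j /\
    2 ^ t * #|realizations (composed_degrees e p b a t.+1)|
      <= #|realizations (Defs.add_pair (composed_degrees e p b a t.+1) i j)|.
Proof.
(* The upper half of the core is numbered backwards, so that the threshold [x + y < 2 * t.+1 - 1]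
   reads [i < j]. *)
have v_lt (i : 'I_t.+1) : a + i < a + 2 * t.+1 + b by have := ltn_ord i; lia.
have w_lt (j : 'I_t.+1) : a + (2 * t.+1 - j.+1) < a + 2 * t.+1 + b by lia.
pose v i := Ordinal (v_lt i); pose w j := Ordinal (w_lt j).
exists (v ord_max), (w ord0); split; first by rewrite /=; lia.
apply: half_graph_growth => [i j|i j|i j|G GD i j].
- by move=> [] /eqP; rewrite eqn_add2l => /eqP/val_inj.
- move=> [] eq_w; apply: val_inj => /=; have := ltn_ord i; have := ltn_ord j.
  by move: eq_w; lia.
- by rewrite -val_eqE /=; have := ltn_ord i; have := ltn_ord j; lia.
have lt_i := ltn_ord i; have lt_j := ltn_ord j.
have ne_vw : v i != w j by rewrite -val_eqE /=; lia.
rewrite (weight_rigidity _ _ (fun u => composed_weight a t.+1 u) _ _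
  (composed_realization e p b a t.+1) GD _ _ _ _ ne_vw).
- rewrite !ffunE /composed_adj (_ : _ != _) //=.
  by rewrite !ifN; lia.
- by move=> x y ne_xy; rewrite !ffunE; apply: composed_weight_gt0.
- by move=> x y ne_xy; rewrite !ffunE; apply: composed_weight_lt0.
(* The two weights add up to [4 (j - i) - 2], which is never zero. *)
- rewrite /composed_weight /= ifN; last by lia.
  rewrite ifT; last by lia.
  rewrite ifN; last by lia.
  by rewrite ifT; lia.
Qed.

(** * Placing the composition in the simple region, and the final count *)

Lemma simple_region_core (n c1 c2 Sigma a t : nat) :
  0 < c2 -> c1 < n -> ~~ odd Sigma -> c2 <= a -> a + 2 * t.+1 <= c1 ->
  a * a + 4 * a * t.+1 + 2 * t.+1 * t.+1 + 2 * n * c2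
    <= Sigma + a + 2 * t.+1 + 2 * a * c2 + 4 * t.+1 * c2 ->
  Sigma + a * a + 2 * t.+1 <= a * (2 * c1 + 1) + 2 * t.+1 * t.+1 ->
  exists D : {ffun 'I_n -> nat},
    [/\ D \in simple_region n Sigma c1 c2, graphic D &
        exists i j : 'I_n, i < j /\
          2 ^ t * #|realizations D| <= #|realizations (Defs.add_pair D i j)|].
Proof.
move=> c2_gt0 lt_c1n ev_S le_c2a le_ac1 lower upper.
have [b def_n] : exists b, n = a + 2 * t.+1 + b by exists (n - (a + 2 * t.+1)); lia.
subst n.
(* The largest row sum that keeps a clique vertex at degree at most [c1]. *)
pose p := c1.+1 - (a + 2 * t.+1).
have def_p : p + (a + 2 * t.+1) = c1.+1 by rewrite subnK //; lia.
have p_bnd : 0 < p <= b by rewrite /p; lia.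
pose m := a * a + 4 * a * t.+1 + 2 * t.+1 * t.+1.
have ev_m : ~~ odd (m + a) by rewrite /m !(oddD, oddM) /=; case: (odd a).
have le_m : m + 2 * b * c2 <= Sigma + a + 2 * t.+1 by move: lower; rewrite /m; lia.
(* The number of edges forced by the degree sum; the halving is exact because [m + a] and [Sigma]
   are even. *)
pose e := (Sigma + a + 2 * t.+1 - m)./2.
have def_e : Sigma + a + 2 * t.+1 = m + 2 * e.
  have : ~~ odd (Sigma + a + 2 * t.+1 - m).
    rewrite oddB; last exact: leq_trans (leq_addr _ _) le_m.
    clearbody m; move: ev_m ev_S; rewrite !oddD oddM /=.
    by case: (odd a); case: (odd m); case: (odd Sigma).
  rewrite /e; move: (leq_trans (leq_addr _ _) le_m); lia.
have ge_e : b * c2 <= e by lia.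
have le_e : e <= a * p.
  have : a * p + a * (a + 2 * t.+1) = a * c1.+1 by rewrite -mulnDr def_p.
  by move: def_e upper; rewrite /m; lia.
exists (composed_degrees e p b a t.+1); split; last exact: composed_growth.
  have D_bnd u : c2 <= composed_degrees e p b a t.+1 u <= c1.
    by rewrite composed_degreesE; apply: composed_degree_bounds.
  have D_sum : \sum_u composed_degrees e p b a t.+1 u = Sigma.
    under eq_bigr => u _ do rewrite composed_degreesE.
    have := composed_degree_sum e p b a t.+1 p_bnd le_e.
    by rewrite -/m -def_e => /addIn/addIn.
  rewrite inE /= /degree_sequence D_sum ev_S eqxx !andbT; apply/andP; split.
    by apply/forallP => u; have := D_bnd u; lia.
  exact/forallP.
exists (composed_graph e p b a t.+1); exact: composed_realization.
Qed.

Local Open Scope ring_scope.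

Theorem theorem1p6 (R : realType) (n c1 c2 Sigma r : nat) (beta : R)
  (c2_gt0 : (0 < c2)%N) (c2_lt_c1 : (c2 < c1)%N) (c1_lt_n : (c1 < n)%N)
  (Sigma_gt0 : (0 < Sigma)%N) (Sigma_even : ~~ odd Sigma)
  (beta_gt0 : 0 < beta) :
  let Q : R := (c1%:R - c2%:R + 1) ^+ 2 - 4 * c2%:R * (n%:R - 1 - c1%:R) in
  let eps : R := 3 * (r%:R + 3) / (beta * (c1%:R - c2%:R)) in
  (1 - beta) * (c1%:R - c2%:R + 1) ^+ 2 >= 4 * c2%:R * (n%:R - 1 - c1%:R) ->
  `| (Sigma%:R - n%:R * c2%:R) / ((c1%:R - c2%:R) / 2)
       - (1 + c1%:R + c2%:R) | <= (1 - eps) * Num.sqrt Q ->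
  exists D : {ffun 'I_n -> nat},
    [/\ D \in simple_region n Sigma c1 c2,
        graphic D &
        partial_pp R D >= 2 `^ (r%:R / 2)].
Proof.
(* The half-graph parameter is [t = (uphalf r).+1]: large enough for [2 ^ (t - 1) >= 2 ^ (r / 2)],
   and with [2 t <= r + 3] small enough for the slack. *)
have le_t_nat : (2 * (uphalf r).+1 <= r + 3)%N by lia.
have le_r_nat : (r <= uphalf r * 2)%N by lia.
move=> Q eps hQ hS.
have c20 : 0 < c2%:R :> R by rewrite ltr0n.
have c21 : c2%:R < c1%:R :> R by rewrite ltr_nat.
have c1n : c1%:R + 1 <= n%:R :> R by rewrite natr1 ler_nat.
have r3 : 3 <= r%:R + 3 :> R by rewrite lerDr.
have rho0 : 0 < r%:R + 3 :> R by lra.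
have := core_slack R _ _ _ _ _ _ c20 c21 c1n beta_gt0 rho0 hQ hS.
set kappa := _ / (c1%:R - c2%:R) => slack.
have SigmaE : Sigma%:R = n%:R * c2%:R + kappa * (c1%:R - c2%:R).
  rewrite /kappa divfK; first by rewrite addrC subrK.
  by rewrite subr_eq0 gt_eqF.
have le_t : 2 * (uphalf r).+1%:R <= r%:R + 3 :> R.
  by rewrite -natrM -natrD ler_nat.
have [a [le_c2a le_ac1 lower upper]] :=
  core_position _ _ _ _ _ _ _ _ (ltn0Sn _) r3 le_t SigmaE slack.
have [D [D_region D_graphic [i [j [lt_ij growth]]]]] :=
  simple_region_core _ _ _ _ _ _ c2_gt0 c1_lt_n Sigma_even le_c2a le_ac1
    lower upper.
exists D; split=> //.
have D_gt0 : 0 < #|realizations D|%:R :> R.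
  by rewrite ltr0n; case: D_graphic => G GD; apply/card_gt0P; exists G.
apply: (@le_trans _ _ (2 ^+ uphalf r)).
  rewrite -powR_mulrn // ler_powR ?ler1n //.
  by rewrite ler_pdivrMr // -natrM ler_nat.
(* The single pair [(i, j)] gives the bound; all other terms are nonnegative. *)
rewrite /partial_pp (bigD1 i) //= (bigD1 j) //= -addrA.
apply: ler_wpDr; last first.
  by rewrite ler_pdivlMr // -natrX -natrM ler_nat.
by apply: addr_ge0; apply: sumr_ge0 => k _; rewrite ?sumr_ge0 // => *;
  apply: divr_ge0.
Qed.
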